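(* Let $\mathit{typep}$ be a (unary) type predicate, let $\mathit{fix}$ be a fixing function for $\mathit{typep}$, and let $\equiv$ be the equivalence relation induced by $\mathit{fix}$, i.e. $x \equiv y$ if and only if $\mathit{fix}(x) = \mathit{fix}(y)$. Let $C(x)$ be a conjecture (a formula in the variable $x$) satisfying the congruence $$ (x \equiv x') \Rightarrow \bigl( C(x) \Leftrightarrow C(x') \bigr) $$ for all $x, x'$. Then $C(x)$ is a theorem if and only if $\mathit{typep}(x) \Rightarrow C(x)$ is a theorem.
   Context: The setting is the logic of ACL2: a first-order logic with equality in which all functions are total and untyped, so variables range over a single universe of all objects. Free variables in formulas are implicitly universally quantified; thus ''$C(x)$ is a theorem'' means that $\forall x : C(x)$ holds (is derivable) in the ambient theory, and ''$\mathit{typep}(x) \Rightarrow C(x)$ is a theorem'' means that $\forall x : (\mathit{typep}(x) \Rightarrow C(x))$ does. A fixing function $\mathit{fix}$ for a unary type predicate $\mathit{typep}$ is a unary function such that (1) $\forall x : \mathit{typep}(\mathit{fix}(x))$, and (2) $\forall x : \mathit{typep}(x) \Rightarrow \mathit{fix}(x) = x$. The properties (1), (2) and the assumed congruence hold in the ambient theory. *)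

(* Defs.v *)
From mathcomp Require Import all_boot.
From Stdlib Require List.

Set Implicit Arguments.
Unset Strict Implicit.
Unset Printing Implicit Defensive.

(* First-order logic with equality over an arbitrary single-sorted signature,
   with classical natural deduction; variables are de Bruijn indices. *)

Record signature : Type := Signature {
  funsym : Type;
  predsym : Type;
  fun_arity : funsym -> nat;
  pred_arity : predsym -> nat }.

Inductive term (S : signature) : Type :=
| Var of nat
| Fun (f : funsym S) of {ffun 'I_(fun_arity f) -> term S}.

Inductive form (S : signature) : Type :=
| Bot
| Eq of term S & term S
| Pred (p : predsym S) of {ffun 'I_(pred_arity p) -> term S}
| Imp of form S & form S
| And of form S & form S
| Or of form S & form S
| All of form S
| Ex of form S.

Arguments Var {S}.
Arguments Bot {S}.

Definition Not S (A : form S) : form S := Imp A Bot.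
Definition Iff S (A B : form S) : form S := And (Imp A B) (Imp B A).

Fixpoint tsubst S (s : nat -> term S) (t : term S) : term S :=
  match t with
  | Var x => s x
  | Fun f a => Fun [ffun i => tsubst s (a i)]
  end.

Definition tshift S (t : term S) : term S := tsubst (fun x => Var x.+1) t.

Definition scons S (t : term S) (s : nat -> term S) (x : nat) : term S :=
  if x is y.+1 then s y else t.

Definition up S (s : nat -> term S) : nat -> term S :=
  scons (Var 0) (fun x => tshift (s x)).

Fixpoint subst S (s : nat -> term S) (A : form S) : form S :=
  match A with
  | Bot => Bot
  | Eq t u => Eq (tsubst s t) (tsubst s u)
  | Pred p a => Pred [ffun i => tsubst s (a i)]
  | Imp B C => Imp (subst s B) (subst s C)
  | And B C => And (subst s B) (subst s C)
  | Or B C => Or (subst s B) (subst s C)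
  | All B => All (subst (up s) B)
  | Ex B => Ex (subst (up s) B)
  end.

Definition shift S (A : form S) : form S := subst (fun x => Var x.+1) A.

(* A(t): variable 0 is replaced by t and the other free variables are lowered
   by one, as in the elimination of a quantifier.  When 0 is the only free
   variable of A, this is A(t) under any number of binders. *)
Definition inst S (A : form S) (t : term S) : form S := subst (scons t Var) A.

Fixpoint tvars_below S (n : nat) (t : term S) : Prop :=
  match t with
  | Var x => x < n
  | Fun f a => forall i, tvars_below n (a i)
  end.

Fixpoint fvars_below S (n : nat) (A : form S) : Prop :=
  match A with
  | Bot => True
  | Eq t u => tvars_below n t /\ tvars_below n u
  | Pred p a => forall i, tvars_below n (a i)
  | Imp B C | And B C | Or B C => fvars_below n B /\ fvars_below n C
  | All B | Ex B => fvars_below n.+1 B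
  end.

Definition unary S (A : form S) : Prop := fvars_below 1 A.

(* T is the set of axioms of the ambient theory, G the local hypotheses.  The
   quantifier rules shift G but not T: the free variables of an axiom are
   implicitly universally quantified. *)
Inductive derivable S (T : form S -> Prop) : seq (form S) -> form S -> Prop :=
| d_axiom G A : T A -> derivable T G A
| d_hyp G A : List.In A G -> derivable T G A
| d_botE G A : derivable T G Bot -> derivable T G A
| d_notnotE G A : derivable T G (Not (Not A)) -> derivable T G A
| d_impI G A B : derivable T (A :: G) B -> derivable T G (Imp A B)
| d_impE G A B :
    derivable T G (Imp A B) -> derivable T G A -> derivable T G B
| d_andI G A B :
    derivable T G A -> derivable T G B -> derivable T G (And A B)
| d_andEl G A B : derivable T G (And A B) -> derivable T G A
| d_andEr G A B : derivable T G (And A B) -> derivable T G B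
| d_orIl G A B : derivable T G A -> derivable T G (Or A B)
| d_orIr G A B : derivable T G B -> derivable T G (Or A B)
| d_orE G A B C :
    derivable T G (Or A B) -> derivable T (A :: G) C ->
    derivable T (B :: G) C -> derivable T G C
| d_allI G A : derivable T (map (@shift S) G) A -> derivable T G (All A)
| d_allE G A t : derivable T G (All A) -> derivable T G (inst A t)
| d_exI G A t : derivable T G (inst A t) -> derivable T G (Ex A)
| d_exE G A B :
    derivable T G (Ex A) -> derivable T (A :: map (@shift S) G) (shift B) ->
    derivable T G B
| d_eqI G t : derivable T G (Eq t t)
| d_eqE G A t u :
    derivable T G (Eq t u) -> derivable T G (inst A t) ->
    derivable T G (inst A u).

Definition is_theorem S (T : form S -> Prop) (A : form S) : Prop :=
  derivable T [::] A.

(* For f of arity 1 the constant family [ffun=> t] is the one-element argument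
   list (t). *)
Definition fun1 S (f : funsym S) (t : term S) : term S :=
  Fun (f := f) [ffun=> t].

(* A unary predicate is given by a formula in one variable, so that it may be
   an atom p(x) as well as f(x) <> nil for a function symbol f and a constant
   nil, which is how a predicate is read when predicates are functions. *)
Definition fixing_function S (T : form S -> Prop)
    (typep : form S) (fix_ : funsym S) : Prop :=
  [/\ fun_arity fix_ = 1,
      is_theorem T (All (inst typep (fun1 fix_ (Var 0)))) &
      is_theorem T (All (Imp (inst typep (Var 0))
                             (Eq (fun1 fix_ (Var 0)) (Var 0))))].

Definition fix_equiv S (fix_ : funsym S) (t u : term S) : form S :=
  Eq (fun1 fix_ t) (fun1 fix_ u).

(* In the scope of the two quantifiers x is Var 1 and x' is Var 0. *)
Definition fix_congruence S (T : form S -> Prop)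
    (fix_ : funsym S) (C : form S) : Prop :=
  is_theorem T
    (All (All (Imp (fix_equiv fix_ (Var 1) (Var 0))
                   (Iff (inst C (Var 1)) (inst C (Var 0)))))).

(* Main.v *)
Require Import Defs.
From mathcomp Require Import all_boot.

Set Implicit Arguments.
Unset Strict Implicit.
Unset Printing Implicit Defensive.

(* From typep(x) => C(x) at fix(x) one gets C(fix(x)); since fix(fix(x)) =
   fix(x), i.e. fix(x) is equivalent to x, the congruence yields C(x).  Because
   typep and C have no other free variable than x, instantiating them commutes
   with substitution, so each instance of a hypothesis is the expected formula.
   The converse is propositional. *)

Section Substitution.
Variable S : signature.
Implicit Types (t u : term S) (A B : form S) (s r q : nat -> term S).

(* The generated principle has no induction hypothesis for the arguments, which
   are nested under a finite function. *)
Lemma term_nested_ind (P : term S -> Prop) :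
  (forall x, P (Var x)) ->
  (forall f (a : {ffun 'I_(fun_arity f) -> term S}),
     (forall i, P (a i)) -> P (Fun a)) ->
  forall t, P t.
Proof.
move=> PV PF; fix IH 1 => -[x|f a]; first exact: PV.
by apply: PF => i; apply: IH.
Qed.

(** The composite is a parameter [q] specified pointwise, so no functional extensionality is needed;
    [up_comp] restores this hypothesis under a binder. *)
Lemma tsubst_comp s r q :
  (forall x, tsubst s (r x) = q x) ->
  forall t, tsubst s (tsubst r t) = tsubst q t.
Proof.
move=> sr; elim/term_nested_ind => [x|f a IH] /=; first exact: sr.
by congr Fun; apply/ffunP => i; rewrite !ffunE IH.
Qed.

Lemma tsubst_Var t : tsubst Var t = t.
Proof.
elim/term_nested_ind: t => [x|f a IH] //=.
by congr Fun; apply/ffunP => i; rewrite ffunE IH.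
Qed.

Lemma tsubst_scons_tshift s t u : tsubst (scons u s) (tshift t) = tsubst s t.
Proof. exact: tsubst_comp. Qed.

Lemma tshift_tsubst s t : tshift (tsubst s t) = tsubst (fun x => tshift (s x)) t.
Proof. exact: tsubst_comp. Qed.

Lemma up_comp s r q :
  (forall x, tsubst s (r x) = q x) ->
  forall x, tsubst (up s) (up r x) = up q x.
Proof.
move=> sr [|x] //=.
by rewrite /up /= tsubst_scons_tshift -tshift_tsubst sr.
Qed.

Lemma subst_comp A s r q :
  (forall x, tsubst s (r x) = q x) -> subst s (subst r A) = subst q A.
Proof.
elim: A s r q => [|t u|p a|A IHA B IHB|A IHA B IHB|A IHA B IHB|A IH|A IH]
  s r q sr //=.
- by rewrite !(tsubst_comp sr).
- by congr Pred; apply/ffunP => i; rewrite !ffunE (tsubst_comp sr).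
- by rewrite (IHA _ _ _ sr) (IHB _ _ _ sr).
- by rewrite (IHA _ _ _ sr) (IHB _ _ _ sr).
- by rewrite (IHA _ _ _ sr) (IHB _ _ _ sr).
- by rewrite (IH _ _ _ (up_comp sr)).
- by rewrite (IH _ _ _ (up_comp sr)).
Qed.

Lemma eq_tsubst_below n s r t :
  (forall x, x < n -> s x = r x) -> tvars_below n t -> tsubst s t = tsubst r t.
Proof.
move=> sr; elim/term_nested_ind: t => [x|f a IH] /=; first exact: sr.
by move=> a_n; congr Fun; apply/ffunP => i; rewrite !ffunE IH.
Qed.

Lemma eq_up_below n s r :
  (forall x, x < n -> s x = r x) -> forall x, x < n.+1 -> up s x = up r x.
Proof. by move=> sr [|x] //= x_n; rewrite /up /= sr. Qed.

(** Only free variables are ever looked up; each binder raises the bound [n] by one, and [up] keeps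
    the agreement. *)
Lemma eq_subst_below A n s r :
  (forall x, x < n -> s x = r x) -> fvars_below n A -> subst s A = subst r A.
Proof.
elim: A n s r => [|t u|p a|A IHA B IHB|A IHA B IHB|A IHA B IHB|A IH|A IH]
  n s r sr //=.
- by case=> t_n u_n; rewrite !(eq_tsubst_below sr).
- move=> a_n; congr Pred; apply/ffunP => i.
  by rewrite !ffunE (eq_tsubst_below sr).
- by case=> A_n B_n; rewrite (IHA _ _ _ sr) // (IHB _ _ _ sr).
- by case=> A_n B_n; rewrite (IHA _ _ _ sr) // (IHB _ _ _ sr).
- by case=> A_n B_n; rewrite (IHA _ _ _ sr) // (IHB _ _ _ sr).
- by move=> A_n; rewrite (IH _ _ _ (eq_up_below sr)).
- by move=> A_n; rewrite (IH _ _ _ (eq_up_below sr)).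
Qed.

(** Both substitutions send variable 0 to [tsubst s t]. They can differ only at later variables,
    none of which is free in [A]. *)
Lemma subst_inst A s t :
  unary A -> subst s (inst A t) = inst A (tsubst s t).
Proof.
move=> A1; rewrite /inst.
rewrite (@subst_comp _ _ _ (fun x => tsubst s (scons t Var x))) //.
by apply: (eq_subst_below _ A1) => -[].
Qed.

Lemma tsubst_fun1 s f t : tsubst s (fun1 f t) = fun1 f (tsubst s t).
Proof. by rewrite /fun1 /=; congr Fun; apply/ffunP => i; rewrite !ffunE. Qed.

Lemma subst_fix_equiv s f t u :
  subst s (fix_equiv f t u) = fix_equiv f (tsubst s t) (tsubst s u).
Proof. by rewrite /fix_equiv -!tsubst_fun1. Qed.

Lemma subst_All s A : subst s (All A) = All (subst (up s) A).
Proof. by []. Qed.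

Lemma subst_Eq s t u : subst s (Eq t u) = Eq (tsubst s t) (tsubst s u).
Proof. by []. Qed.

Lemma subst_Imp s A B : subst s (Imp A B) = Imp (subst s A) (subst s B).
Proof. by []. Qed.

Lemma subst_Iff s A B : subst s (Iff A B) = Iff (subst s A) (subst s B).
Proof. by []. Qed.

End Substitution.

Section Derivations.
Variables (S : signature) (T : form S -> Prop).
Implicit Types (A B C : form S) (t u : term S).

Lemma derivable_imp_const G A B : derivable T G B -> derivable T G (Imp A B).
Proof.
(* Modus ponens with the tautology [Imp B (Imp A B)] takes the place of weakening. *)
apply: d_impE; apply/d_impI/d_impI/d_hyp.
by right; left.
Qed.

Lemma all_inst_elim G A t :
  unary A -> derivable T G (All (inst A (Var 0))) -> derivable T G (inst A t).
Proof. by move=> A1 /(d_allE t); rewrite {1}/inst subst_inst. Qed.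

Lemma fix_congruence_elim fix_ C t u :
  unary C -> fix_congruence T fix_ C ->
  is_theorem T (Imp (fix_equiv fix_ t u) (Iff (inst C t) (inst C u))).
Proof.
move=> C1 /(d_allE t); rewrite {1}/inst subst_All => /(d_allE u).
rewrite {1}/inst !(subst_Imp, subst_Iff, subst_fix_equiv, subst_inst) //.
(* The outer instantiation turned [Var 1] into [tshift t] below the inner quantifier; instantiating
   that one with [u] cancels the shift. *)
by rewrite [tsubst (up _) _]/= tsubst_scons_tshift tsubst_Var.
Qed.

End Derivations.

Theorem theorem1 (S : signature) (T : form S -> Prop)
    (typep : form S) (fix_ : funsym S) (C : form S)
    (typep_unary : unary typep)
    (fix_fixing : fixing_function T typep fix_)
    (C_unary : unary C)
    (C_congr : fix_congruence T fix_ C) :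
  is_theorem T (All (inst C (Var 0))) <->
  is_theorem T (All (Imp (inst typep (Var 0)) (inst C (Var 0)))).
Proof.
case: fix_fixing => _ typep_fix fix_id.
(* The hypothesis list stays empty under the quantifier, so [Var 0] is now an arbitrary object x. *)
split=> [allC | all_typepC]; apply: d_allI => /=.
  exact/derivable_imp_const/all_inst_elim.
pose fx := fun1 fix_ (Var 0).
have typep_fx : derivable T [::] (inst typep fx).
  move: (d_allE (Var 0) typep_fix).
  by rewrite {1}/inst subst_inst // tsubst_fun1.
have C_fx : derivable T [::] (inst C fx).
  move: (d_allE fx all_typepC); rewrite {1}/inst subst_Imp !subst_inst //.
  by move/d_impE; apply.
have fix_fx : derivable T [::] (fix_equiv fix_ fx (Var 0)).
  (* The goal unfolds to fix(fix(x)) = fix(x), the second fixing property at fix(x), whose premise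
     is [typep_fx]. *)
  move: (d_allE fx fix_id).
  rewrite {1}/inst subst_Imp subst_Eq subst_inst // tsubst_fun1.
  by move/d_impE; apply.
have congr_fx := fix_congruence_elim fx (Var 0) C_unary C_congr.
exact: d_impE (d_andEl (d_impE congr_fx fix_fx)) C_fx.
Qed.
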